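(* Let $G$ be a fixed edge-ordered graph with minimal edge $e_0$. If $e_0$ is isolated in $G$, then either $sat_m(n,G)=O(1)$ or $sat_m(n,G)=\Theta(n)$. Otherwise, if $e_0$ is not isolated, then $sat_m(n,G)=\Omega(n)$.
   Context: An edge-ordered graph is a finite simple graph together with a linear order on its edge set (usually given by an injective labeling $l:E\to\mathbb{N}$ or $l:E\to\mathbb{R}$). An edge-ordered graph $H$ contains $G$ (has a copy of $G$) if $G$ is isomorphic, by an isomorphism respecting the edge-order, to a subgraph of $H$ with the induced order; otherwise $H$ is $G$-free. The minimal edge $e_0$ of $G$ is the edge with the smallest label; an edge is isolated if it shares no vertex with any other edge. $sat_m(n,G)$ is the minimum number of edges in a $G$-free edge-ordered graph $H$ on $n$ vertices such that adding to $H$ any missing edge, inserted at the beginning of the linear order (i.e. with a label smaller than all labels of $H$), creates a copy of $G$. Asymptotic notation is for $n\to\infty$ with $G$ fixed ($n$ is assumed large enough). *)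

(* Defs.v *)
From HB Require Import structures.
From mathcomp Require Import all_boot all_order all_algebra.
From mathcomp Require Import boolp reals topology normedtype sequences landau.

Set Implicit Arguments.
Unset Strict Implicit.
Unset Printing Implicit Defensive.

(* [edge_le] is only meaningful on [edges]. *)
Record eograph (V : finType) := EOGraph {
  edges : {set {set V}};
  edge_le : rel {set V};
  edges_card2 : {in edges, forall e : {set V}, #|e| = 2};
  edge_le_total : {in edges &, total edge_le};
  edge_le_anti : {in edges &, antisymmetric edge_le};
  edge_le_trans : {in edges & &, transitive edge_le}
}.

Definition contains (V W : finType) (G : eograph V) (H : eograph W) : Prop :=
  exists f : V -> W,
    [/\ injective f,
        {in edges G, forall e : {set V}, f @: e \in edges H} &
        {in edges G &, forall a b : {set V},
           edge_le H (f @: a) (f @: b) = edge_le G a b}].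

Definition free (V W : finType) (G : eograph V) (H : eograph W) : Prop :=
  ~ contains G H.

Definition minimal_edge (V : finType) (G : eograph V) (e0 : {set V}) : Prop :=
  e0 \in edges G /\ {in edges G, forall e : {set V}, edge_le G e0 e}.

Definition isolated_edge (V : finType) (G : eograph V) (e : {set V}) : Prop :=
  {in edges G, forall e' : {set V}, e' != e -> [disjoint e & e']}.

Section AddFirst.
Variables (V : finType) (H : eograph V) (e : {set V}) (he : #|e| = 2).

Definition first_le : rel {set V} :=
  fun a b => (a == e) || (b != e) && edge_le H a b.

Let in_old (a : {set V}) : a != e -> a \in e |: edges H -> a \in edges H.
Proof. by move=> /negPf ae; rewrite in_setU1 ae. Qed.

Fact add_first_card2 : {in e |: edges H, forall a : {set V}, #|a| = 2}.
Proof. by move=> a /setU1P[-> //|]; apply: edges_card2. Qed.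

Fact add_first_total : {in e |: edges H &, total first_le}.
Proof.
move=> a b aE bE; rewrite /first_le.
case: eqVneq => //= ae; case: eqVneq => //= be.
by rewrite edge_le_total ?in_old.
Qed.

Fact add_first_anti : {in e |: edges H &, antisymmetric first_le}.
Proof.
move=> a b aE bE; rewrite /first_le.
case: (eqVneq a e) => [->|ae] /=; case: (eqVneq b e) => [->|be] //=.
by move=> ab; apply: (edge_le_anti (e := H)) ab; apply: in_old.
Qed.

Fact add_first_trans : {in e |: edges H & &, transitive first_le}.
Proof.
move=> b a c bE aE cE; rewrite /first_le.
case: (eqVneq a e) => //= ae; case: (eqVneq b e) => //= be.
case: (eqVneq c e) => //= ce.
by apply: edge_le_trans; apply: in_old.
Qed.

(* The missing edge [e] inserted at the beginning of the order of [H]. *)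
Definition add_first : eograph V :=
  EOGraph add_first_card2 add_first_total add_first_anti add_first_trans.

End AddFirst.

Definition m_saturated (V W : finType) (G : eograph V) (H : eograph W) : Prop :=
  free G H /\
  forall (e : {set W}) (he : #|e| = 2),
    e \notin edges H -> contains G (add_first H he).

Definition m_sat_size (V : finType) (G : eograph V) (n : nat) : pred nat :=
  fun m => `[< exists H : eograph 'I_n, m_saturated G H /\ #|edges H| = m >].

(* The value 0 for an empty family is a convention that only matters for
   edgeless [G]: see [sat_mP]. *)
Definition sat_m (n : nat) (V : finType) (G : eograph V) : nat :=
  if pselect (exists m, m_sat_size G n m) is left ex then ex_minn ex else 0.

Lemma m_saturated_exists (n : nat) (V : finType) (G : eograph V) :
  edges G != set0 -> exists H : eograph 'I_n, m_saturated G H.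
Proof.
move=> /set0Pn[e0 e0G].
suff step k (H : eograph 'I_n) : #|~: edges H| <= k -> free G H ->
    exists H' : eograph 'I_n, m_saturated G H'.
  have [H0 H0E] : exists H0 : eograph 'I_n, edges H0 = set0.
    unshelve eexists.
      by refine (@EOGraph _ set0 (fun _ _ => true) _ _ _ _) => a; rewrite inE.
    by [].
  apply: (step _ H0 (leqnn _)) => -[f [_ fG _]].
  by have := fG _ e0G; rewrite H0E inE.
elim: k H => [|k IH] H Hk freeH.
  exists H; split=> // e he eH; move: Hk; rewrite leqn0 cards_eq0 => /eqP Hk.
  have : e \in ~: edges H by rewrite inE.
  by rewrite Hk inE.
have [sat|] := pselect (m_saturated G H); first by exists H.
move=> /not_andP[//|] /existsNP[e /existsNP[he /not_implyP[eH nc]]].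
apply: (IH (add_first H he)) => //.
rewrite -ltnS (leq_trans _ Hk) //; apply: proper_card.
rewrite properE setCS subsetUr /=; apply/subsetPn; exists e.
  by rewrite inE.
by rewrite !inE eqxx.
Qed.

Lemma sat_mP (n : nat) (V : finType) (G : eograph V) : edges G != set0 ->
  (exists H : eograph 'I_n, m_saturated G H /\ #|edges H| = sat_m n G) /\
  (forall H : eograph 'I_n, m_saturated G H -> sat_m n G <= #|edges H|).
Proof.
move=> /(m_saturated_exists n)[H0 satH0]; rewrite /sat_m.
case: pselect => [ex|[]]; last first.
  by exists #|edges H0|; apply/asboolP; exists H0.
case: ex_minnP => m /asboolP mP mmin; split=> // H satH.
by apply: mmin; apply/asboolP; exists H.
Qed.

(* Main.v *)
(** If a saturated [H] leaves at least [|V| + 2] vertices isolated, further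
    isolated vertices may be added: a copy of [G] in the padded graph can be
    moved back into [H], and a missing edge that uses new vertices behaves like
    one that uses old isolated vertices. Hence [sat_m] is then bounded;
    otherwise every saturated graph has linearly many edges.

    If [e0] is not isolated, a saturated graph has at most one isolated vertex:
    an edge joining two of them would have to play the role of [e0].

    If [e0] is isolated, extend a copy of [G - e0] greedily to a saturated
    graph. An edge disjoint from the vertices of that copy would complete it to
    a copy of [G], so every edge meets a set of bounded size. *)
Require Import Defs.
From mathcomp Require Import all_boot all_order all_algebra.
From mathcomp Require Import perm zify.
From mathcomp Require Import boolp reals topology normedtype sequences landau.

Set Implicit Arguments.
Unset Strict Implicit.
Unset Printing Implicit Defensive.

(** * Copies, and how they interact with an edge inserted first *)

Definition copy (V W : finType) (f : V -> W) (G : eograph V) (H : eograph W) :=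
  [/\ injective f,
      {in edges G, forall e : {set V}, f @: e \in edges H} &
      {in edges G &, forall a b : {set V},
         edge_le H (f @: a) (f @: b) = edge_le G a b}].

(** The complement of this set consists of the isolated vertices. *)
Definition covered (V : finType) (G : eograph V) : {set V} := cover (edges G).

Lemma edge_covered (V : finType) (G : eograph V) (e : {set V}) x :
  e \in edges G -> x \in e -> x \in covered G.
Proof. by move=> eG xe; apply/bigcupP; exists e. Qed.

Lemma copy_covered (V W : finType) (f : V -> W) (G : eograph V)
    (H : eograph W) x :
  copy f G H -> x \in covered G -> f x \in covered H.
Proof.
move=> [_ fG _] /bigcupP[e eG xe].
exact: edge_covered (fG e eG) (imset_f _ xe).
Qed.

(** Edges see only covered vertices, so the images of isolated vertices may be rerouted as long as
    injectivity survives. *)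
Lemma eq_copy (V W : finType) (f g : V -> W) (G : eograph V) (H : eograph W) :
  copy f G H -> injective g -> {in covered G, g =1 f} -> copy g G H.
Proof.
move=> [_ fG fle] ginj gf.
have gfE e : e \in edges G -> g @: e = f @: e.
  move=> eG; apply: eq_in_imset => x xe.
  exact: gf (edge_covered eG xe).
split=> // [e eG|a b aG bG]; first by rewrite gfE ?fG.
by rewrite !gfE ?fle.
Qed.

Lemma copy_comp (U V W : finType) (f : U -> V) (g : V -> W) (F : eograph U)
    (G : eograph V) (H : eograph W) :
  copy f F G -> copy g G H -> copy (g \o f) F H.
Proof.
move=> [finj fG fle] [ginj gG gle].
split=> [|e eG|a b aG bG]; first exact: inj_comp.
  by rewrite (imset_comp g f) gG ?fG.
by rewrite !(imset_comp g f) gle ?fG ?fle.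
Qed.

Lemma copy_add_first (V W : finType) (f : V -> W) (G : eograph V)
    (H : eograph W) (e : {set V}) (e' : {set W}) (he : #|e| = 2) (he' : #|e'| = 2) :
  copy f G H -> f @: e = e' -> copy f (add_first G he) (add_first H he').
Proof.
move=> [finj fG fle]; move: he' => /[swap] <- he'.
split=> // [a /setU1P[->|aG]|a b aE bE] /=.
- exact: setU11.
- by rewrite in_setU1 fG ?orbT.
- rewrite /first_le !(inj_eq (imset_inj finj)).
  move: aE bE; rewrite !in_setU1.
  by case: eqVneq => //= _ aG; case: eqVneq => //= _ bG; rewrite fle.
Qed.

Lemma copy_add_firstl (V W : finType) (f : V -> W) (G : eograph V)
    (H : eograph W) (e : {set W}) (he : #|e| = 2) :
  copy f G (add_first H he) ->
  {in edges G, forall a : {set V}, f @: a != e} -> copy f G H.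
Proof.
move=> [finj fG fle] fe.
split=> // [a aG|a b aG bG].
  by have /setU1P[E|//] := fG _ aG; have := fe _ aG; rewrite E eqxx.
rewrite -fle //= /first_le.
by rewrite (negPf (fe _ aG)) (fe _ bG).
Qed.

(** As [H] is [G]-free, some edge of [G] is sent to [e]. Since [e] comes first, that edge precedes
    [e0], hence equals it. *)
Lemma copy_new_edge (V W : finType) (f : V -> W) (G : eograph V)
    (H : eograph W) (e0 : {set V}) (e : {set W}) (he : #|e| = 2) :
  minimal_edge G e0 -> ~ contains G H -> copy f G (add_first H he) -> f @: e0 = e.
Proof.
move=> [e0G e0min] frH fcopy; apply/eqP; apply: contra_notT frH => ne.
exists f; apply: (copy_add_firstl fcopy) => a aG.
case: fcopy => _ _ fle; apply: contraNneq ne => fae.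
suff -> : e0 = a by apply/eqP.
apply: (edge_le_anti (e := G)) => //.
by rewrite e0min // -fle //= /first_le fae eqxx.
Qed.

(** * Transport of an edge-ordered graph along an injection *)

Section Pushforward.
Variables (V W : finType) (j : V -> W) (G : eograph V) (E : {set {set V}}).
Hypotheses (jinj : injective j) (EG : E \subset edges G).

Let pushed_le : rel {set W} := fun a b => edge_le G (j @^-1: a) (j @^-1: b).

Lemma preimset_inj_imset (A : {set V}) : j @^-1: (j @: A) = A.
Proof. by apply/setP=> x; rewrite inE mem_imset. Qed.

Let pushedP a : a \in [set j @: (x : {set V}) | x in E] ->
  (j @^-1: a \in edges G) * (j @: (j @^-1: a) = a).
Proof.
by case/imsetP=> x xE ->; rewrite preimset_inj_imset (subsetP EG).
Qed.

Fact pushforward_card2 :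
  {in [set j @: (x : {set V}) | x in E], forall a : {set W}, #|a| = 2}.
Proof.
by move=> a /pushedP aP; rewrite -aP card_imset // (edges_card2 aP.1).
Qed.

Fact pushforward_total :
  {in [set j @: (x : {set V}) | x in E] &, total pushed_le}.
Proof.
by move=> a b /pushedP aP /pushedP bP; rewrite /pushed_le edge_le_total ?aP ?bP.
Qed.

Fact pushforward_anti :
  {in [set j @: (x : {set V}) | x in E] &, antisymmetric pushed_le}.
Proof.
move=> a b /pushedP aP /pushedP bP ab.
by rewrite -aP -[b]bP (edge_le_anti aP.1 bP.1 ab).
Qed.

Fact pushforward_trans :
  {in [set j @: (x : {set V}) | x in E] & &, transitive pushed_le}.
Proof.
move=> b a c /pushedP bP /pushedP aP /pushedP cP.
exact: edge_le_trans bP.1 aP.1 cP.1.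
Qed.

(** A subset [E] of the edges is allowed so that this serves both to pad a graph and to place [G]
    without [e0]. *)
Definition pushforward : eograph W :=
  EOGraph pushforward_card2 pushforward_total pushforward_anti pushforward_trans.

Lemma pushforward_le (a b : {set V}) :
  edge_le pushforward (j @: a) (j @: b) = edge_le G a b.
Proof. by rewrite /= /pushed_le !preimset_inj_imset. Qed.

Lemma card_pushforward : #|edges pushforward| = #|E|.
Proof. by rewrite card_imset //; apply: imset_inj. Qed.

End Pushforward.

(** * Adding isolated vertices to a saturated graph *)

Lemma inj_into (V W : finType) (A : {set W}) :
  #|V| <= #|A| -> exists2 h : V -> W, injective h & forall v, h v \in A.
Proof.
move=> leVA; exists (fun v => enum_val (widen_ord leVA (enum_rank v))).
  move=> u v /enum_val_inj/(congr1 val) /= uv.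
  by apply: enum_rank_inj; apply: val_inj.
by move=> v; apply: enum_valP.
Qed.

Section Padding.
Variables (V W W' : finType) (G : eograph V) (H : eograph W) (j : W -> W').
Hypotheses (jinj : injective j) (satH : m_saturated G H)
  (isoH : #|V|.+2 <= #|~: covered H|).

Let H' := pushforward jinj (subxx (edges H)).

Let jcopy : copy j H H'.
Proof. by split=> // [e eH|a b _ _]; [apply: imset_f | apply: pushforward_le]. Qed.

Let covered_pad : covered H' = j @: covered H.
Proof.
apply/setP=> x; apply/idP/imsetP=> [/bigcupP[_ /imsetP[e eH ->] /imsetP[y ye ->]]|].
  by exists y => //; apply: edge_covered ye.
by case=> y yH ->; apply: copy_covered yH.
Qed.

(* A copy of [G] in [H'] may place isolated vertices of [G] outside the image
   of [j]; these are moved to isolated vertices of [H]. *)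
Lemma not_contains_pad : ~ contains G H'.
Proof.
case=> f fcopy; have [finj _ _] := fcopy.
have [h hinj hiso] : exists2 h : V -> W, injective h & forall v, h v \in ~: covered H.
  by apply: inj_into; apply: leq_trans isoH; rewrite -addn2 leq_addr.
pose g v := if f v \in covered H' then f v else j (h v).
have hH' v : j (h v) \notin covered H' by have := hiso v; rewrite covered_pad mem_imset // inE.
have ginj : injective g.
  move=> u v; rewrite /g; case: ifPn => fu; case: ifPn => fv.
  - exact: finj.
  - by move=> E; move: fu; rewrite E (negPf (hH' _)).
  - by move=> E; move: fv; rewrite -E (negPf (hH' _)).
  - by move=> /jinj /hinj.
have gcopy : copy g G H'.
  by apply: (eq_copy fcopy ginj) => x xG; rewrite /g (copy_covered fcopy).
(* All values of [g] lie in the image of [j], so [g] factors through [j]; the factor [k] is a copy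
   in [H]. *)
have [k kg] : exists k : V -> W, forall v, g v = j (k v).
  apply: (@fin_all_exists _ (fun=> W) (fun v w => g v = j w)) => v; rewrite /g.
  case: ifPn => [|_]; last by exists (h v).
  by rewrite covered_pad => /imsetP[w _ ->]; exists w.
case: satH => + _; apply; exists k; case: gcopy => _ gG gle.
have gE (e : {set V}) : g @: e = j @: (k @: e).
  by rewrite -imset_comp; apply: eq_imset => v /=.
split=> [u v kuv|e eG|a b aG bG].
- by apply: ginj; rewrite !kg kuv.
- have := gG _ eG; rewrite gE => /imsetP[e' e'H].
  by move/(imset_inj jinj) ->.
- by rewrite -gle // !gE pushforward_le.
Qed.

(** A missing edge [e] of [H'] is pulled back to a missing edge of [H], uncovered ends being
    replaced by isolated vertices of [H]. The copy of [G] obtained there is carried to [H'] plus [e]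
    by a variant [phi] of [j]. *)
Lemma m_saturated_pad : m_saturated G H'.
Proof.
split=> [|e he eH]; first exact: not_contains_pad.
have /card_gt1P[u [v []]] : 1 < #|~: covered H| by apply: leq_trans isoH.
rewrite !inE => uH vH uv.
have pre z w : w \notin covered H -> exists z',
    (z = j z' /\ z' \in covered H) \/ (z \notin covered H' /\ z' = w).
  move=> wH; case: (boolP (z \in covered H')) => [|zH]; last by exists w; right.
  by rewrite covered_pad => /imsetP[z' ? ->]; exists z'; left.
have /eqP/cards2P[x [y [xy eE]]] := he.
have [x' x'P] := pre x u uH; have [y' y'P] := pre y v vH.
(* Reserving [u] for [x] and [v] for [y] keeps the ends distinct. *)
have xy' : x' != y'.
  apply/eqP => E; move: x'P y'P; rewrite -{}E.
  case=> -[xE x'E] [] [yE y'E].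
  - by rewrite xE yE eqxx in xy.
  - by rewrite y'E (negPf vH) in x'E.
  - by rewrite x'E (negPf uH) in y'E.
  - by rewrite -x'E -y'E eqxx in uv.
(* Two transpositions correct [j] at [x'] and then at [y']. The second starts from [t (j y')]
   because [t] moves [j y'] when [x] equals it. *)
pose t := tperm (j x') x.
pose phi w := tperm (t (j y')) y (t (j w)).
have phi_inj : injective phi by move=> a b /perm_inj /perm_inj /jinj.
have phix : phi x' = x.
  rewrite /phi {2}/t tpermL tpermD // 1?eq_sym //.
  by rewrite -(tpermL (j x') x) (inj_eq perm_inj) (inj_eq jinj).
have phiy : phi y' = y by rewrite /phi tpermL.
(* Each transposition is trivial if its end of [e] is covered, and otherwise swaps two uncovered
   vertices. *)
have tH : {in covered H, forall w, t (j w) = j w}.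
  move=> w wH; rewrite /t; case: x'P => -[xE x'E]; first by rewrite xE tperm1 perm1.
  rewrite tpermD //; last by apply: contraNneq xE => ->; rewrite covered_pad mem_imset.
  by rewrite (inj_eq jinj); apply: contraNneq uH => x'w; rewrite -x'E x'w.
have phiH : {in covered H, phi =1 j}.
  move=> w wH; rewrite /phi (tH w) //.
  case: y'P => -[yE y'E]; first by rewrite tH // yE tperm1 perm1.
  rewrite tpermD //; last by apply: contraNneq yE => ->; rewrite covered_pad mem_imset.
  rewrite -(tH w) // (inj_eq perm_inj) (inj_eq jinj).
  by apply: contraNneq vH => y'w; rewrite -y'E y'w.
have phicopy : copy phi H H' := eq_copy jcopy phi_inj phiH.
have phie : phi @: [set x'; y'] = e by rewrite imsetU1 imset_set1 phix phiy -eE.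
have he' : #|[set x'; y']| = 2 by rewrite cards2 xy'.
have e'H : [set x'; y'] \notin edges H.
  apply: contra eH => e'H.
  have x'H : x' \in covered H by apply: edge_covered e'H _; rewrite set21.
  have y'H : y' \in covered H by apply: edge_covered e'H _; rewrite set22.
  rewrite -phie; case: phicopy => _ /(_ _ e'H) + _; exact.
have [f fcopy] := satH.2 _ he' e'H.
exists (phi \o f).
exact: copy_comp fcopy (copy_add_first he' he phicopy phie).
Qed.

End Padding.

(** * Counting edges and isolated vertices *)

Lemma card_le_edges_isolated (V : finType) (G : eograph V) :
  #|V| <= 2 * #|edges G| + #|~: covered G|.
Proof.
rewrite -(cardsC (covered G)) leq_add2r.
apply: leq_trans (leq_card_cover _).1 _.
rewrite (eq_bigr (fun=> 2)) => [|e eG]; last exact: edges_card2 eG.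
by rewrite sum_nat_const mulnC.
Qed.

(** Each edge is the pair of coordinates of a point of [S] times the vertex set. *)
Lemma card_edges_meeting (V : finType) (G : eograph V) (S : {set V}) :
  {in edges G, forall e : {set V}, ~~ [disjoint e & S]} ->
  #|edges G| <= #|S| * #|V|.
Proof.
move=> meetS; rewrite -[#|V|]cardsT -cardsX.
apply: leq_trans (leq_imset_card (fun p => [set p.1; p.2]) _).
apply/subset_leq_card/subsetP=> e eG.
have /pred0Pn[x /andP[/= xe xS]] := meetS e eG.
have /cards1P[y yE] : #|e :\ x| == 1.
  by have := edges_card2 eG; rewrite (cardsD1 x) xe add1n => -[->].
by apply/imsetP; exists (x, y); rewrite ?inE ?xS //= -yE setD1K.
Qed.

(** Join two isolated vertices: the new edge is the image of [e0]. An edge of [G] sharing a vertex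
    with [e0] would go to an old edge covering one of the two, so [e0] would be isolated. *)
Lemma card_isolated_le1 (V W : finType) (G : eograph V) (H : eograph W)
    (e0 : {set V}) :
  minimal_edge G e0 -> ~ isolated_edge G e0 -> m_saturated G H ->
  #|~: covered H| <= 1.
Proof.
move=> e0min niso [frH satH]; rewrite leqNgt; apply: contra_notN niso.
move=> /card_gt1P[x [y []]]; rewrite !inE => xH yH xy.
have he : #|[set x; y]| = 2 by rewrite cards2 xy.
have eH : [set x; y] \notin edges H.
  by apply: contra xH => eH; apply: edge_covered eH _; rewrite set21.
have [f fcopy] := satH _ he eH.
have fe0 := copy_new_edge e0min frH fcopy.
have [finj fG _] := fcopy.
move=> e eG ne; rewrite -setI_eq0; apply/set0Pn => -[v].
rewrite inE => /andP[ve0 ve].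
have /setU1P[fe|feH] := fG _ eG.
  by move: ne; rewrite -(inj_eq (imset_inj finj)) fe fe0 eqxx.
have fvH : f v \in covered H := edge_covered feH (imset_f f ve).
have : f v \in [set x; y] by rewrite -fe0 imset_f.
by rewrite !inE => /orP[] /eqP fvE; rewrite fvE ?(negPf xH) ?(negPf yH) in fvH.
Qed.

(** * Greedy saturation and the linear upper bound *)

(** Induction on the number of missing edges, with [P] as the invariant of the greedy process. *)
Lemma m_saturated_greedy (V W : finType) (G : eograph V) (P : eograph W -> Prop)
    (H0 : eograph W) :
  (forall H, P H -> ~ contains G H) ->
  (forall H (e : {set W}) (he : #|e| = 2), P H -> e \notin edges H ->
     ~ contains G (add_first H he) -> P (add_first H he)) ->
  P H0 -> exists H, P H /\ m_saturated G H.
Proof.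
move=> Pfree Pstep.
have [k] := ubnP #|~: edges H0|; elim: k H0 => // k IH H Hk PH.
have [sat|] := pselect (m_saturated G H); first by exists H.
move=> /not_andP[/(_ (Pfree _ PH))//|].
move=> /existsNP[e /existsNP[he /not_implyP[eH nc]]].
apply: IH (Pstep _ _ _ PH eH nc); rewrite -ltnS (leq_trans _ Hk) // ltnS.
apply: proper_card; rewrite properE setCS subsetUr /=; apply/subsetPn.
by exists e; rewrite !inE ?eqxx.
Qed.

Section IsolatedUpperBound.
Variables (V W : finType) (G : eograph V) (e0 : {set V}) (j : V -> W).
Hypotheses (e0min : minimal_edge G e0) (e0iso : isolated_edge G e0).
Hypothesis jinj : injective j.

Let S := j @: ~: e0.

Let placed (H : eograph W) :=
  {in edges G :\ e0, forall a : {set V}, j @: a \in edges H} /\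
  {in edges G :\ e0 &, forall a b : {set V},
     edge_le H (j @: a) (j @: b) = edge_le G a b}.

(** Redirect [j] on [e0] to the ends of [e]. Injectivity holds because [e] avoids [S], the other
    edges keep their images because [e0] is isolated, and both [e0] and [e] come first. *)
Lemma contains_add_first_disjoint (H : eograph W) (e : {set W}) (he : #|e| = 2) :
  placed H -> [disjoint e & S] -> contains G (add_first H he).
Proof.
move=> [jG jle] eS; have [e0G e0le] := e0min.
have /eqP/cards2P[a [b [ab e0E]]] := edges_card2 e0G.
have /eqP/cards2P[x [y [xy eE]]] := he.
have jS v : v \notin e0 -> j v \notin e.
  move=> ve0; rewrite (disjointFl eS) //; apply: imset_f.
  by rewrite inE.
pose f v := if v == a then x else if v == b then y else j v.
have fe0 : f @: e0 = e.
  by rewrite e0E imsetU1 imset_set1 /f !eqxx eq_sym (negPf ab) -eE.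
have fj v : v \notin e0 -> f v = j v.
  by rewrite e0E !inE negb_or /f => /andP[/negPf -> /negPf ->].
have finj : injective f.
  move=> u v; case: (boolP (u \in e0)) => ue0; case: (boolP (v \in e0)) => ve0.
  - move: ue0 ve0; rewrite e0E !inE.
    have fa : f a = x by rewrite /f eqxx.
    have fb : f b = y by rewrite /f eqxx eq_sym (negPf ab).
    by move=> /orP[] /eqP -> /orP[] /eqP -> //; rewrite fa fb => E;
       rewrite E eqxx in xy.
  - move=> E; have := imset_f f ue0.
    by rewrite fe0 E fj // (negPf (jS _ ve0)).
  - move=> E; have := imset_f f ve0.
    by rewrite fe0 -E fj // (negPf (jS _ ue0)).
  - by rewrite !fj //; apply: jinj.
have fjE (c : {set V}) : c \in edges G -> c != e0 -> f @: c = j @: c.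
  move=> cG ce0; apply: eq_in_imset => v vc; apply: fj.
  by rewrite (disjointFl (e0iso cG ce0)).
exists f; split=> // [c cG|c d cG dG] /=.
  have [->|ce0] := eqVneq c e0; first by rewrite fe0 setU11.
  by rewrite fjE // in_setU1 jG ?orbT // !inE ce0.
rewrite /first_le -fe0 !(inj_eq (imset_inj finj)).
have [->|ce0] := eqVneq c e0; first by rewrite e0le.
have [->|de0] /= := eqVneq d e0.
  apply/esym/negP => ce; case/eqP: ce0.
  by apply: (edge_le_anti (e := G)) => //; rewrite ce e0le.
by rewrite !fjE // jle // !inE ?ce0 ?de0.
Qed.

Lemma m_saturated_linear :
  exists H : eograph W, m_saturated G H /\ #|edges H| <= #|V| * #|W|.
Proof.
have [e0G e0le] := e0min.
(* The last clause is preserved: a new edge disjoint from [S] would create a copy of [G]. *)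
pose P (H : eograph W) := [/\ ~ contains G H, placed H &
  {in edges H, forall e : {set W}, ~~ [disjoint e & S]}].
pose H0 := pushforward jinj (subD1set (edges G) e0).
have [||| H [[_ _ meetS] satH]] := @m_saturated_greedy V W G P H0.
- by move=> H [].
- move=> H e he [_ [jG jle] meetS] eH nc; split=> //.
  + split=> [a aG|a b aG bG] /=; first by rewrite in_setU1 jG ?orbT.
    have neq c : c \in edges G :\ e0 -> (j @: c == e) = false.
      by move=> cG; apply: contraNF eH => /eqP <-; apply: jG.
    by rewrite /first_le !neq // jle.
  + move=> a /setU1P[->|/meetS //].
    by apply/negP => /(contains_add_first_disjoint he (conj jG jle)).
- split.
  (* [H0] has one edge fewer than [G]. *)
  + case=> f [finj fG _].
    suff : #|edges G| <= #|edges H0|.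
      by rewrite card_pushforward (cardsD1 e0 (edges G)) e0G ltnn.
    rewrite -(card_imset _ (imset_inj finj)); apply: subset_leq_card.
    by apply/subsetP=> _ /imsetP[e eG ->]; apply: fG.
  + split=> [a aG|a b aG bG]; first exact: imset_f.
    exact: pushforward_le.
  + move=> _ /imsetP[a /setD1P[ae0 aG] ->].
    have /card_gt0P[v va] : 0 < #|a| by rewrite (edges_card2 aG).
    apply/pred0Pn; exists (j v) => /=; rewrite !imset_f //.
    by rewrite inE (disjointFl (e0iso aG ae0)).
exists H; split=> //; apply: leq_trans (card_edges_meeting meetS) _.
by rewrite leq_mul2r (leq_trans (leq_imset_card _ _)) ?max_card ?orbT.
Qed.

End IsolatedUpperBound.

(* Imported only here because [classical_sets] shadows the notations and lemmas
   of [finset]. *)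
From mathcomp Require Import classical_sets.
Import GRing.Theory Num.Theory numFieldNormedType.Exports.
Local Open Scope classical_set_scope.
Local Open Scope ring_scope.

(** * Asymptotic bounds *)

Lemma eventually_le_eqO (R : realType) (f g : nat -> nat) (N c : nat) :
  (forall n, (N <= n)%N -> (f n <= c * g n)%N) ->
  (fun n => (f n)%:R : R^o) =O_\oo (fun n => (g n)%:R : R^o).
Proof.
(* The successor makes the constant positive even when [c] is 0. *)
move=> fg; apply/eqO_exP; exists c.+1%:R; first by rewrite ltr0n.
near=> n; rewrite !normr_nat -natrM ler_nat.
apply: leq_trans (fg n _) _; last by rewrite leq_mul2r leqnSn orbT.
by near: n; apply: nbhs_infty_ge.
Unshelve. all: by end_near. Qed.

Lemma linear_lower_bound (R : realType) (V : finType) (G : eograph V) (k : nat) :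
  edges G != finset.set0 ->
  (forall n (H : eograph 'I_n), m_saturated G H ->
     (#|finset.setC (covered H)| <= k)%N) ->
  (fun n => n%:R : R^o) =O_\oo (fun n => (sat_m n G)%:R : R^o).
Proof.
(* With m edges, n <= 2m + k; once n >= 2k, this yields n <= 4m. *)
move=> G0 isok; apply: (@eventually_le_eqO R id (fun n => sat_m n G) (2 * k)%N 4) => n kn /=.
have [[H [satH <-]] _] := sat_mP n G0.
have := card_le_edges_isolated H; rewrite card_ord.
by have := isok n H satH; lia.
Qed.

Theorem theorem5 (R : realType) (V : finType) (G : eograph V) (e0 : {set V})
    (he0 : minimal_edge G e0) :
  (isolated_edge G e0 ->
     (fun n : nat => (sat_m n G)%:R : R^o) =O_\oo (fun _ : nat => 1 : R^o) \/
     (fun n : nat => (sat_m n G)%:R : R^o) =Theta_\oo (fun n : nat => n%:R : R^o)) /\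
  (~ isolated_edge G e0 ->
     (fun n : nat => (sat_m n G)%:R : R^o) =Omega_\oo (fun n : nat => n%:R : R^o)).
Proof.
have G0 : edges G != finset.set0 by apply/set0Pn; exists e0; case: he0.
split=> [iso|niso]; last first.
  rewrite eqOmegaE eqOmegaO; apply: (linear_lower_bound R (k := 1)) => // n H.
  exact: card_isolated_le1 he0 niso.
(* A single saturated graph with enough isolated vertices, on any number of vertices, decides for
   O(1): padding it keeps its edge count. *)
have [|noiso] := pselect (exists (n : nat) (H : eograph 'I_n),
    m_saturated G H /\ (#|V|.+2 <= #|finset.setC (covered H)|)%N).
  case=> n [H [satH isoH]]; left.
  apply: (@eventually_le_eqO R (fun n => sat_m n G) (fun=> 1%N) n #|edges H|) => m nm.
  have jinj : injective (widen_ord nm) by move=> a b /(congr1 val) /= /val_inj.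
  have [_ /(_ _ (m_saturated_pad jinj satH isoH))] := sat_mP m G0.
  by rewrite card_pushforward muln1.
right; rewrite eqThetaE bigThetaE; split; last first.
  rewrite eqOmegaO; apply: (linear_lower_bound R (k := #|V|.+1)) => // n H satH.
  by rewrite leqNgt; apply/negP => isoH; apply: noiso; exists n, H.
(* The threshold [#|V|] lets [V] embed in ['I_n]; the constant [#|V|] bounds the size of the set met
   by all edges. *)
apply: (@eventually_le_eqO R (fun n => sat_m n G) id #|V| #|V|) => n Vn.
have [j jinj _] : exists2 j : V -> 'I_n, injective j & forall v, j v \in finset.setT.
  by apply: inj_into; rewrite cardsT card_ord.
have [H [satH Hle]] := m_saturated_linear he0 iso jinj.
by have [_ /(_ H satH)/leq_trans] := sat_mP n G0; apply; rewrite card_ord in Hle.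
Qed.
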